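(* Let $\alpha$ be a countable ordinal written in the form $\alpha=\omega^{\gamma_n+r_n}s_n+\dots+\omega^{\gamma_0+r_0}s_0+k$ (Cantor normal form), where $k\in\omega$, $r_i\in\omega$, $s_i\in\mathbb N=\omega\setminus\{0\}$, $\gamma_i\in \mathrm{Lim}\cup\{1\}$ for $i\le n$, and $\gamma_n+r_n>\dots>\gamma_0+r_0$. Then $$\mathrm{sq}\,\langle \mathbb P(\alpha),\subset\rangle\;\cong\;\prod_{i=0}^n\Big(\big(\mathrm{rp}^{r_i}(P(\omega^{\gamma_i})/\mathcal I_{\omega^{\gamma_i}})\big)^+\Big)^{s_i}.$$
   Context: $\mathrm{Lim}$ denotes the class of limit ordinals. For an ordinal $\beta$, $\mathbb P(\beta)=\{A\subset\beta:\langle A,\in\rangle\cong\langle\beta,\in\rangle\}$ and $\mathcal I_\beta=\{A\subset\beta:\langle\beta,\in\rangle\text{ does not embed into }\langle A,\in\rangle\}$; for $\beta=\omega^{\delta}$, $\delta>0$, $\mathcal I_\beta$ is an ideal and $P(\beta)/\mathcal I_\beta$ is the quotient Boolean algebra. For a Boolean algebra $\mathbb B$, $\mathbb B^+$ denotes the poset of its nonzero elements with the Boolean order. For a Boolean algebra $\mathbb B=\langle B,\le\rangle$, the reduced power $\mathrm{rp}(\mathbb B)$ is $B^\omega/\!\equiv$ ordered by $[\langle b_i\rangle]\le_\equiv[\langle c_i\rangle]$ iff $b_i\le c_i$ for all but finitely many $i$, where $\langle b_i\rangle\equiv\langle c_i\rangle$ iff $b_i=c_i$ for all but finitely many $i$;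 $\mathrm{rp}^0(\mathbb B)=\mathbb B$, $\mathrm{rp}^{m+1}(\mathbb B)=\mathrm{rp}(\mathrm{rp}^m(\mathbb B))$. For a partial order $\mathbb P=\langle P,\le\rangle$, define $p\le^* q$ iff $\forall r\le p\,\exists s\le r\; s\le q$; the separative quotient $\mathrm{sq}(\mathbb P)$ is $P/\!=^*$ (where $p=^*q$ iff $p\le^*q\wedge q\le^*p$) ordered by $[p]\trianglelefteq[q]$ iff $p\le^* q$. Products of posets are ordered coordinatewise, and $\mathbb Q^{s}$ is the product of $s$ copies of $\mathbb Q$. *)

(* Defs.v *)
From HB Require Import structures.
From mathcomp Require Import all_boot all_order.
From mathcomp Require Import generic_quotient finmap.
From mathcomp Require Import mathcomp_extra boolp classical_sets functions cardinality.

Set Implicit Arguments.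
Unset Strict Implicit.
Unset Printing Implicit Defensive.

Import Order.Theory.

Local Open Scope classical_set_scope.
Local Open Scope order_scope.

(******************************************************************************)
(* Ordinals are represented by well-ordered types, and equality of ordinals   *)
(* by isomorphism; an ordinal beta, as the set of all smaller ordinals, is    *)
(* the carrier of such a type.                                                *)
(******************************************************************************)

HB.mixin Record Total_isWellOrder d T of Order.Total d T := {
  lt_wf : well_founded (fun x y : T => x < y)
}.

#[short(type="wellOrderType")]
HB.structure Definition WellOrder d :=
  { T of Total_isWellOrder d T & Order.Total d T }.

Fact ordinal_display : Order.disp_t. Proof. by []. Qed.

Notation ordinalType := (wellOrderType ordinal_display).

HB.factory Record isStrictWellOrder (d : Order.disp_t) T of Choice T := {
  ltw : T -> T -> Prop;
  ltw_trans : forall x y z, ltw x y -> ltw y z -> ltw x z;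
  ltw_total : forall x y, ltw x y \/ x = y \/ ltw y x;
  ltw_wf : well_founded ltw
}.

HB.builders Context d T of isStrictWellOrder d T.

Let lt (x y : T) : bool := `[< ltw x y >].
Let le (x y : T) : bool := (x == y) || lt x y.

Let lt_irr : irreflexive lt.
Proof.
move=> x; apply/asboolP; elim/(well_founded_ind ltw_wf): x => x IH xx.
exact: (IH x xx).
Qed.

Let lt_trans : transitive lt.
Proof.
move=> y x z /asboolP xy /asboolP yz; apply/asboolP; exact: ltw_trans xy yz.
Qed.

Let lt_total x y : x != y -> lt x y || lt y x.
Proof.
move=> /eqP xy; case: (ltw_total x y) => [h|[//|h]].
- by rewrite /lt; apply/orP; left; apply/asboolP.
- by rewrite /lt; apply/orP; right; apply/asboolP.
Qed.

HB.instance Definition _ := @Order.LtOrder.Build d T le lt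
  (fun x y => if lt x y then x else y) (fun x y => if lt x y then y else x)
  (fun _ _ => erefl) (fun _ _ => erefl) (fun _ _ => erefl)
  lt_irr lt_trans lt_total.

Let wf : well_founded (fun x y : T => (x < y)%O).
Proof.
move=> x; elim/(well_founded_ind ltw_wf): x => x IH.
constructor=> y /asboolP; exact: IH.
Qed.

HB.instance Definition _ := @Total_isWellOrder.Build d T wf.

HB.end.

Section OrdinalArithmetic.

Definition fin_ordinal (k : nat) : Type := 'I_k.

HB.instance Definition _ k := Choice.on (fin_ordinal k).

Section FinOrdinal.
Variable k : nat.

Definition fin_lt (i j : fin_ordinal k) : Prop := ((i : 'I_k) < (j : 'I_k))%N.

Fact fin_lt_trans i j l : fin_lt i j -> fin_lt j l -> fin_lt i l.
Proof. exact: ltn_trans. Qed.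

Fact fin_lt_total i j : fin_lt i j \/ i = j \/ fin_lt j i.
Proof.
rewrite /fin_lt; case: (ltngtP (i : 'I_k) (j : 'I_k)) => h; [by left|by right; right|].
by right; left; apply: val_inj.
Qed.

Fact fin_lt_wf : well_founded fin_lt.
Proof.
have main m : forall i : 'I_k, (i < m)%N -> Acc fin_lt i.
  elim: m => [i|m IH i]; first by rewrite ltn0.
  rewrite ltnS => im; constructor=> j ji; apply: IH; exact: leq_trans ji im.
by move=> i; exact: (main k i (ltn_ord i)).
Qed.

HB.instance Definition _ := isStrictWellOrder.Build ordinal_display
  (fin_ordinal k) fin_lt_trans fin_lt_total fin_lt_wf.

End FinOrdinal.

(* Ordinal sum: a copy of A followed by a copy of B. *)
Definition osum (A B : Type) : Type := A + B.

HB.instance Definition _ (A B : choiceType) := Choice.copy (osum A B) (A + B)%type.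

Section OrdinalSum.
Variables A B : ordinalType.

Definition osum_lt (u v : osum A B) : Prop :=
  match u, v with
  | inl a, inl a' => a < a'
  | inl _, inr _ => True
  | inr _, inl _ => False
  | inr b, inr b' => b < b'
  end.

Fact osum_lt_trans u v w : osum_lt u v -> osum_lt v w -> osum_lt u w.
Proof. by case: u v w => [a|b] [a'|b'] [a''|b''] //=; exact: lt_trans. Qed.

Fact osum_lt_total u v : osum_lt u v \/ u = v \/ osum_lt v u.
Proof.
case: u v => [a|b] [a'|b'] /=; [|by left|by right; right|].
- by case: (ltgtP a a') => [|| ->]; [left|right; right|right; left].
- by case: (ltgtP b b') => [|| ->]; [left|right; right|right; left].
Qed.

Fact osum_lt_wf : well_founded osum_lt.
Proof.
have wfl a : Acc osum_lt (inl a).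
  elim/(well_founded_ind (@lt_wf _ A)): a => a IH.
  constructor=> -[a'|b'] h; [exact: IH|case: h].
move=> [a|b]; first exact: wfl.
elim/(well_founded_ind (@lt_wf _ B)): b => b IH.
constructor=> -[a'|b'] h; [exact: wfl|exact: IH].
Qed.

HB.instance Definition _ := isStrictWellOrder.Build ordinal_display
  (osum A B) osum_lt_trans osum_lt_total osum_lt_wf.

End OrdinalSum.

Definition oadd (A B : ordinalType) : ordinalType := osum A B.

(* The product A * B is B copies of A, so the B-coordinate is compared first. *)
Definition oprod (A B : ordinalType) : Type := B *lexi[ordinal_display] A.

HB.instance Definition _ (A B : ordinalType) :=
  Order.Total.copy (oprod A B) (B *lexi[ordinal_display] A).

Fact oprod_lt_wf (A B : ordinalType) :
  well_founded (fun u v : oprod A B => u < v).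
Proof.
move=> [b a]; elim/(well_founded_ind (@lt_wf _ B)): b a => b IHb.
elim/(well_founded_ind (@lt_wf _ A)) => a IHa.
constructor=> -[b' a']; rewrite ltEprodlexi /= => /andP[b'b /implyP h].
case: (ltgtP b' b) b'b h => [b'b _ _|//|-> _ h]; first exact: IHb.
by apply: IHa; exact: h.
Qed.

HB.instance Definition _ (A B : ordinalType) :=
  @Total_isWellOrder.Build ordinal_display (oprod A B) (@oprod_lt_wf A B).

Definition omul (A B : ordinalType) : ordinalType := oprod A B.

(* omega ^ C is the set of finitely supported functions from C to omega,      *)
(* two such functions being compared at the largest argument where they       *)
(* differ (the Cantor normal form with exponents in C).                       *)
Definition opow (C : choiceType) : Type := {fsfun C -> nat with 0%N}.

HB.instance Definition _ (C : choiceType) :=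
  Choice.copy (opow C) {fsfun C -> nat with 0%N}.

Coercion fun_of_opow (C : choiceType) (f : opow C) : C -> nat :=
  fun_of_fsfun (f : {fsfun C -> nat with 0%N}).

Section OrdinalPower.
Variable C : ordinalType.
Implicit Types f g h : opow C.

Definition opow_lt f g : Prop :=
  exists x : C, (f x < g x)%N /\ forall y : C, x < y -> f y = g y.

Lemma opowP f g : f =1 g -> f = g.
Proof. by move=> fg; apply/fsfunP. Qed.

Fact opow_lt_trans f g h : opow_lt f g -> opow_lt g h -> opow_lt f h.
Proof.
move=> [x [fgx fg]] [y [ghy gh]]; case: (ltgtP x y) => [xy|yx|exy].
- exists y; split; first by rewrite fg.
  by move=> z yz; rewrite fg ?gh //; exact: lt_trans yz.
- exists x; split; first by rewrite -gh.
  by move=> z xz; rewrite fg ?gh //; exact: lt_trans xz.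
- subst y; exists x; split; first exact: ltn_trans ghy.
  by move=> z xz; rewrite fg ?gh.
Qed.

Lemma ordinal_seq_max (s : seq C) (P : pred C) : has P s ->
  exists2 x, P x & forall y, y \in s -> P y -> y <= x.
Proof.
elim: s => // a s IH /=; case Ps: (has P s) => /=.
  case: (IH Ps) => x Px xmax _; case Pa: (P a); last first.
    exists x => // y; rewrite inE => /orP[/eqP->|]; last exact: xmax.
    by rewrite Pa.
  case: (leP a x) => [ax|xa].
    by exists x => // y; rewrite inE => /orP[/eqP->//|]; exact: xmax.
  exists a => // y; rewrite inE => /orP[/eqP->//|ys Py].
  exact: le_trans (xmax _ ys Py) (ltW xa).
rewrite orbF => Pa; exists a => // y; rewrite inE => /orP[/eqP->//|ys Py].
by move/hasPn: (negbT Ps) => /(_ y ys); rewrite Py.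
Qed.

Fact opow_lt_total f g : opow_lt f g \/ f = g \/ opow_lt g f.
Proof.
pose s := (enum_fset (finsupp f) ++ enum_fset (finsupp g)).
have off y : y \notin s -> f y = g y.
  rewrite mem_cat negb_or => /andP[yf yg].
  by rewrite /fun_of_opow !fsfun_dflt.
case Ps: (has (fun x => f x != g x) s); last first.
  right; left; apply: opowP => y; apply/eqP.
  case ys: (y \in s); last by rewrite off ?ys.
  by move/hasPn: (negbT Ps) => /(_ y ys); rewrite negbK.
have [x fgx xmax] := ordinal_seq_max Ps.
have above y : x < y -> f y = g y.
  move=> xy; apply/eqP; apply/negPn/negP => fgy.
  case ys: (y \in s); last by rewrite off ?ys ?eqxx in fgy.
  by have := xmax _ ys fgy; rewrite leNgt xy.
case: (ltngtP (f x) (g x)) fgx => // h _.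
- by left; exists x.
- by right; right; exists x; split=> // y /above.
Qed.

Definition opow_set f (x : C) (m : nat) : opow C :=
  [fsfun y in x |` finsupp f => if y == x then m else f y]%fset.

Lemma opow_setE f x m y : opow_set f x m y = if y == x then m else f y.
Proof.
rewrite /opow_set /fun_of_opow fsfunE in_fset1U; case: eqP => //= _.
by case: finsuppP.
Qed.

Definition opow0 : opow C := [fsfun].

Lemma opow0E x : opow0 x = 0%N.
Proof. by rewrite /opow0 /fun_of_opow fsfunE. Qed.

Lemma opow_Acc0 f : f =1 (fun=> 0%N) -> Acc opow_lt f.
Proof. by move=> f0; constructor=> g [x [h _]]; rewrite f0 in h. Qed.

Lemma opow_degree f : (exists x, f x != 0%N) ->
  exists2 x, f x != 0%N & forall y, x < y -> f y = 0%N.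
Proof.
move=> [z fz].
have Ps : has (fun x => f x != 0%N) (enum_fset (finsupp f)).
  by apply/hasP; exists z => //; rewrite mem_finsupp.
have [x fx xmax] := ordinal_seq_max Ps; exists x => // y xy.
apply/eqP/negPn/negP => fy.
by have := xmax y; rewrite mem_finsupp leNgt xy => /(_ fy fy).
Qed.

Lemma opow_Acc_bounded (x : C) f :
  (forall y, x < y -> f y = 0%N) -> Acc opow_lt f.
Proof.
elim/(well_founded_ind (@lt_wf _ C)): x f => x IHx.
have Accx g : (forall y, x <= y -> g y = 0%N) -> Acc opow_lt g.
  move=> g0; case: (pselect (exists z, g z != 0%N)) => [gn0|g1]; last first.
    by apply: opow_Acc0 => z; apply/eqP/negPn/negP => gz; apply: g1; exists z.
  have [z gz z0] := opow_degree gn0.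
  apply: (IHx z) => //; rewrite ltNge; apply/negP => xz.
  by rewrite g0 ?eqxx in gz.
suff main m g : (forall y, x <= y -> g y = 0%N) -> Acc opow_lt (opow_set g x m).
  move=> f f0; rewrite (_ : f = opow_set (opow_set f x 0%N) x (f x)); last first.
    by apply: opowP => y; rewrite !opow_setE; case: eqP => // ->.
  apply: main => y; rewrite opow_setE le_eqVlt eq_sym.
  by case: eqP => //= _ /f0.
elim/ltn_ind: m g => m IHm g g0.
have Ag := Accx g g0; elim: Ag g0 => {}g _ IHg g0.
constructor=> h [z [hz hgz]].
have h0 y : x < y -> h y = 0%N.
  move=> xy; case: (ltgtP z y) => [zy|yz|ezy].
  - by rewrite hgz // opow_setE (gt_eqF xy) g0 // ltW.
  - move: hz; rewrite opow_setE (gt_eqF (lt_trans xy yz)) g0 //.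
    exact/ltW/(lt_trans xy yz).
  - by move: hz; rewrite ezy opow_setE (gt_eqF xy) g0 // ltW.
pose h' := opow_set h x 0%N.
have h'0 y : x <= y -> h' y = 0%N.
  by rewrite opow_setE le_eqVlt eq_sym; case: eqP => //= _ /h0.
have hE : h = opow_set h' x (h x).
  by apply: opowP => y; rewrite !opow_setE; case: eqP => // ->.
case: (ltgtP z x) => [zx|xz|ezx]; rewrite hE.
- have hx : h x = m by rewrite hgz // opow_setE eqxx.
  rewrite hx; apply: IHg => //; exists z; split.
    by move: hz; rewrite !opow_setE (lt_eqF zx).
  move=> y zy; rewrite !opow_setE; case: eqP => [->|yx]; first by rewrite g0.
  by rewrite hgz // opow_setE; case: eqP.
- by move: hz; rewrite opow_setE (gt_eqF xz) g0 // ltW.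
- by apply: IHm => //; move: hz; rewrite ezx opow_setE eqxx.
Qed.

Fact opow_lt_wf : well_founded opow_lt.
Proof.
move=> f; case: (pselect (exists z, f z != 0%N)) => [fn0|f1]; last first.
  by apply: opow_Acc0 => z; apply/eqP/negPn/negP => fz; apply: f1; exists z.
have [z _ z0] := opow_degree fn0; exact: (opow_Acc_bounded z0).
Qed.

HB.instance Definition _ := isStrictWellOrder.Build ordinal_display
  (opow C) opow_lt_trans opow_lt_total opow_lt_wf.

Definition omega_pow : ordinalType := opow C.

End OrdinalPower.

End OrdinalArithmetic.

Definition order_isomorphic d1 d2 (P : porderType d1) (Q : porderType d2) : Prop :=
  exists f : P -> Q, bijective f /\ {mono f : x y / x <= y}.

(* A < B as ordinals: A is isomorphic to a proper initial segment of B. *)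
Definition ordinal_lt (A B : ordinalType) : Prop :=
  exists f : A -> B, {mono f : x y / x <= y} /\
    exists b : B, range f = [set y | y < b].

(* 0 is not a limit ordinal. *)
Definition limit_ordinal (A : ordinalType) : Prop :=
  (exists x : A, True) /\ forall x : A, exists y : A, x < y.

Definition is_copy (B : ordinalType) (A : set B) : Prop :=
  exists f : B -> B, set_bij [set: B] A f /\ {mono f : x y / x <= y}.

(* The poset P(B), ordered by inclusion. *)
Definition copies (B : ordinalType) : Type := {A : set B | `[< is_copy A >]}.

HB.instance Definition _ (B : ordinalType) := SubChoice.on (copies B).
HB.instance Definition _ (B : ordinalType) :=
  [SubChoice_isSubPOrder of copies B by <: with set_display].

(* The family I_B. *)
Definition nonembedding (B : ordinalType) : set (set B) :=
  [set A | ~ exists f : B -> B, {mono f : x y / x <= y} /\ range f `<=` A].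

Section WellOrderEmbeddings.
Variable X : ordinalType.
Implicit Types (S : set X).

Lemma ordinal_least (P : set X) :
  (exists x, P x) -> exists x, P x /\ forall y, P y -> x <= y.
Proof.
move=> [x]; elim/(well_founded_ind (@lt_wf _ X)): x => x IH Px.
case: (pselect (exists2 y, P y & y < x)) => [[y Py yx]|nP].
  exact: IH yx Py.
exists x; split=> // y Py; rewrite leNgt; apply/negP => yx.
by apply: nP; exists y.
Qed.

Lemma ordinal_homo_ge (f : X -> X) :
  {homo f : x y / x < y} -> forall x, x <= f x.
Proof.
move=> fh; elim/(well_founded_ind (@lt_wf _ X)) => x IH.
rewrite leNgt; apply/negP => fx.
by have := IH _ fx; rewrite leNgt fh.
Qed.

Let next S (y : X) (e : forall z : X, z < y -> X) : set X :=
  [set s | S s /\ forall z (zy : z < y), e z zy < s].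

Let enum_step S (y : X) (e : forall z : X, z < y -> X) : X :=
  xget y [set s | next S e s /\ forall t, next S e t -> s <= t].

Let enumS S : X -> X := Fix (@lt_wf _ X) (fun=> X) (enum_step S).

Let enumSE S y : enumS S y = enum_step S (fun z (_ : z < y) => enumS S z).
Proof.
apply: (Fix_eq (@lt_wf _ X) (fun=> X) (enum_step S)) => x f g fg; congr enum_step.
by apply: functional_extensionality_dep => z; apply: functional_extensionality_dep.
Qed.

Lemma ordinal_enum S :
  (exists f : X -> X, {homo f : x y / x < y} /\ forall x, S (f x)) \/
  (exists y : X, exists h : X -> X,
    {in S &, {homo h : s t / s < t}} /\ forall s, S s -> h s < y).
Proof.
pose e := enumS S.
pose above y s := S s /\ forall z, z < y -> e z < s.
have eP y : (exists s, above y s) ->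
    above y (e y) /\ forall t, above y t -> e y <= t.
  move=> /ordinal_least [s [ys smin]].
  rewrite /e enumSE /enum_step; case: xgetP => [t -> [h1 h2]//|].
  by move=> /(_ s); case; split.
case: (pselect (forall y, exists s, above y s)) => [all_good|].
  left; exists e; split=> [x y xy|x].
    by have [[_ ->]] := eP y (all_good y).
  by have [[]] := eP x (all_good x).
move=> /existsNP/ordinal_least [y [bad ymin]]; right; exists y.
have good z : z < y -> exists s, above z s.
  move=> zy; apply: contrapT => nz.
  by have := ymin z nz; rewrite leNgt zy.
have below s : exists z, S s -> (z < y /\ s <= e z) /\
    forall w, w < y /\ s <= e w -> z <= w.
  case: (pselect (S s)) => [Ss|nS]; last by exists s.
  have /ordinal_least [z zP] : exists z, z < y /\ s <= e z.
    apply: contrapT => nz; apply: bad; exists s; split=> // z zy.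
    by rewrite ltNge; apply/negP => se; apply: nz; exists z.
  by exists z.
have [h hP] := choice below; exists h; split=> [s t /set_mem Ss /set_mem St st|s Ss].
  have [[ty te] tmin] := hP t St; have [_ smin] := hP s Ss.
  have [_ emin] := eP _ (good _ ty).
  have [w [wt sw]] : exists w, w < h t /\ s <= e w.
    apply: contrapT => nw.
    have : above (h t) s.
      split=> // z zt; rewrite ltNge; apply/negP => se.
      by apply: nw; exists z.
    by move=> /emin; rewrite leNgt (lt_le_trans st te).
  by apply: (le_lt_trans _ wt); apply: smin; split=> //; exact: lt_trans wt ty.
by have [[]] := hP s Ss.
Qed.

End WellOrderEmbeddings.

Section OmegaPowIndecomposable.
Variable C : ordinalType.
Implicit Types f g h : omega_pow C.

Lemma omega_pow_ltE f g : (f < g) = `[< opow_lt f g >].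
Proof. by []. Qed.

Definition nat_sum f g : omega_pow C :=
  [fsfun x in (finsupp f `|` finsupp g)%fset => f x + g x]%N.

Lemma nat_sumE f g x : nat_sum f g x = (f x + g x)%N.
Proof.
rewrite /nat_sum /fun_of_opow fsfunE in_fsetU.
by case: (finsuppP f) => //= _; case: (finsuppP g).
Qed.

Lemma nat_sumC f g : nat_sum f g = nat_sum g f.
Proof. by apply: opowP => x; rewrite !nat_sumE addnC. Qed.

Lemma nat_sum_ltl f f' g : f < f' -> nat_sum f g < nat_sum f' g.
Proof.
rewrite !omega_pow_ltE => /asboolP [x [ff' e]]; apply/asboolP; exists x.
by rewrite !nat_sumE ltn_add2r; split=> // y /e; rewrite !nat_sumE => ->.
Qed.

Lemma nat_sum_ltr f g g' : g < g' -> nat_sum f g < nat_sum f g'.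
Proof. by rewrite ![nat_sum f _]nat_sumC; exact: nat_sum_ltl. Qed.

Lemma nat_sum_le f f' g g' : f <= f' -> g <= g' -> nat_sum f g <= nat_sum f' g'.
Proof.
rewrite !le_eqVlt => /orP[/eqP->|ff'] /orP[/eqP->|gg']; rewrite ?eqxx //.
- by rewrite nat_sum_ltr ?orbT.
- by rewrite nat_sum_ltl ?orbT.
- by rewrite (lt_trans (nat_sum_ltl _ ff') (nat_sum_ltr _ gg')) orbT.
Qed.

Lemma omega_pow_indecomposable (S T : set (omega_pow C)) :
  (forall x, S x \/ T x) ->
  exists f : omega_pow C -> omega_pow C,
    {homo f : x y / x < y} /\ ((forall x, S (f x)) \/ forall x, T (f x)).
Proof.
move=> ST.
case: (ordinal_enum S) => [[f [fh fS]]|[y [h1 [h1h h1y]]]].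
  by exists f; split=> //; left.
case: (ordinal_enum T) => [[f [fh fT]]|[z [h2 [h2h h2z]]]].
  by exists f; split=> //; right.
exfalso.
have sup (U : set (omega_pow C)) (k : omega_pow C -> omega_pow C) w :
    (forall s, U s -> k s < w) ->
    {in U &, {homo k : s t / s < t}} ->
    exists p : omega_pow C -> omega_pow C,
    [/\ forall x, p x <= w, {homo p : x x' / x <= x'} &
        forall x x', U x -> x < x' -> p x < p x'].
  move=> kw kh.
  have ex x : exists u, (forall s, U s -> s < x -> k s < u) /\
      forall v, (forall s, U s -> s < x -> k s < v) -> u <= v.
    by apply: ordinal_least; exists w => s Us _; exact: kw.
  have [p pP] := choice ex; exists p; split=> [x|x x' xx'|x x' Ux xx'].
  - by have [_] := pP x; apply=> s Us _; exact: kw.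
  - have [_] := pP x; apply=> s Us sx; have [+ _] := pP x'; apply=> //.
    exact: lt_le_trans xx'.
  - have [_ px] := pP x; have [px' _] := pP x'.
    apply: le_lt_trans (px' _ Ux xx'); apply: px => s Us sx.
    exact: kh _ _ (mem_set Us) (mem_set Ux) sx.
have [p1 [p1y p1m p1s]] := sup _ _ _ h1y h1h.
have [p2 [p2z p2m p2s]] := sup _ _ _ h2z h2h.
pose p x := nat_sum (p1 x) (p2 x).
have ph : {homo p : x x' / x < x'}.
  move=> x x' xx'; case: (ST x) => [Sx|Tx].
    apply: lt_le_trans (nat_sum_ltl _ (p1s _ _ Sx xx')) _.
    by apply: nat_sum_le => //; apply/p2m/ltW.
  apply: lt_le_trans (nat_sum_ltr _ (p2s _ _ Tx xx')) _.
  by apply: nat_sum_le => //; apply/p1m/ltW.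
pose w := nat_sum y z.
have pw x : p x <= w by apply: nat_sum_le.
case: (pselect (exists c : C, True)) => [[c _]|nC].
  pose w' := nat_sum w (opow_set (opow0 C) c 1).
  have ww' : w < w'.
    rewrite omega_pow_ltE; apply/asboolP; exists c.
    rewrite /w' nat_sumE opow_setE eqxx addn1; split=> // d cd.
    by rewrite nat_sumE opow_setE (gt_eqF cd) opow0E addn0.
  by have := ordinal_homo_ge ph w'; rewrite leNgt (le_lt_trans (pw _) ww').
have one (f g : omega_pow C) : f = g.
  by apply: opowP => c; case: nC; exists c.
case: (ST (opow0 C)) => [/h1y|/h2z].
- by rewrite (one (h1 _) y) ltxx.
- by rewrite (one (h2 _) z) ltxx.
Qed.

Local Notation I := (@nonembedding (omega_pow C)).

Lemma nonembedding0 : I set0.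
Proof. by move=> [f [_ f0]]; apply: (f0 (f (opow0 C))); exists (opow0 C). Qed.

Lemma nonembeddingS A B : A `<=` B -> I B -> I A.
Proof.
move=> AB nB [f [fm fA]]; apply: nB; exists f; split=> //.
exact: subset_trans AB.
Qed.

Lemma nonembeddingU A B : I A -> I B -> I (A `|` B).
Proof.
move=> nA nB [f [fm fAB]].
have [|g [gh gAB]] := @omega_pow_indecomposable (f @^-1` A) (f @^-1` B).
  by move=> x; apply: (fAB (f x)); exists x.
have gm := le_mono gh.
case: gAB => [gA|gB]; [apply: nA|apply: nB]; exists (f \o g); split.
- by move=> x y /=; rewrite fm gm.
- by move=> _ [x _ <-]; exact: gA.
- by move=> x y /=; rewrite fm gm.
- by move=> _ [x _ <-]; exact: gB.
Qed.

End OmegaPowIndecomposable.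

(* A preorder whose quotient is a Boolean algebra, together with the           *)
(* equivalence by which the quotient is taken.                                *)
Record preBoolean := PreBoolean {
  pb_sort :> choiceType;
  pb_eqv : equiv_rel pb_sort;
  pb_le : rel pb_sort;
  pb_meet : pb_sort -> pb_sort -> pb_sort;
  pb_join : pb_sort -> pb_sort -> pb_sort;
  pb_compl : pb_sort -> pb_sort;
  pb_bot : pb_sort;
  pb_top : pb_sort;
  pb_eqvE : forall x y, pb_eqv x y = pb_le x y && pb_le y x;
  pb_trans : transitive pb_le;
  pb_meetP : forall x y z, pb_le x (pb_meet y z) = pb_le x y && pb_le x z;
  pb_joinP : forall x y z, pb_le (pb_join x y) z = pb_le x z && pb_le y z;
  pb_distr : forall x y z, pb_le (pb_meet (pb_join x y) z)
                             (pb_join (pb_meet x z) (pb_meet y z));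
  pb_botP : forall x, pb_le pb_bot x;
  pb_topP : forall x, pb_le x pb_top;
  pb_joinC : forall x, pb_le pb_top (pb_join x (pb_compl x));
  pb_meetC : forall x, pb_le (pb_meet x (pb_compl x)) pb_bot
}.

Definition bool_quot (d : Order.disp_t) (A : preBoolean) : Type :=
  {eq_quot (pb_eqv A)}%qT.

HB.instance Definition _ d A := Choice.on (@bool_quot d A).
HB.instance Definition _ d A : EqQuotient _ (pb_eqv A) (@bool_quot d A) :=
  EqQuotient.on (@bool_quot d A).

Section BooleanQuotient.
Variables (d : Order.disp_t) (A : preBoolean).
Local Notation Q := (bool_quot d A).
Local Notation cl := (\pi_Q : A -> Q)%qT.

Definition bq_le (x y : Q) : bool := pb_le (repr x) (repr y).

Let pb_refl : reflexive (@pb_le A).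
Proof.
by move=> x; have := equiv_refl (pb_eqv A) x; rewrite pb_eqvE andbb.
Qed.

Let repr_le (x : A) : pb_le (repr (cl x)) x && pb_le x (repr (cl x)).
Proof. by rewrite -pb_eqvE -eqmodE reprK. Qed.

Lemma bq_le_pi (x y : A) : bq_le (cl x) (cl y) = pb_le x y.
Proof.
have /andP[x1 x2] := repr_le x; have /andP[y1 y2] := repr_le y.
apply/idP/idP => h.
  exact: pb_trans (pb_trans x2 h) y1.
exact: pb_trans (pb_trans x1 h) y2.
Qed.

Let bq_refl : reflexive bq_le.
Proof. by move=> x; rewrite /bq_le. Qed.

Let bq_anti : antisymmetric bq_le.
Proof.
move=> x y; rewrite /bq_le -pb_eqvE => /eqmodP.
by rewrite !reprK.
Qed.

Let bq_trans : transitive bq_le.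
Proof. by move=> y x z; exact: pb_trans. Qed.

HB.instance Definition _ :=
  Order.Le_isPOrder.Build d Q bq_refl bq_anti bq_trans.

Lemma bool_quot_leE (x y : A) : (cl x <= cl y) = pb_le x y.
Proof. exact: bq_le_pi. Qed.

Let bq_meet (x y : Q) : Q := cl (pb_meet (repr x) (repr y)).
Let bq_join (x y : Q) : Q := cl (pb_join (repr x) (repr y)).

Let bq_meetP x y z : (x <= bq_meet y z) = (x <= y) && (x <= z).
Proof.
by rewrite -[x]reprK -{2}[y]reprK -{2}[z]reprK !bool_quot_leE pb_meetP.
Qed.

Let bq_joinP x y z : (bq_join x y <= z) = (x <= z) && (y <= z).
Proof.
by rewrite -[z]reprK -{2}[x]reprK -{2}[y]reprK !bool_quot_leE pb_joinP.
Qed.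

HB.instance Definition _ := Order.POrder_isMeetSemilattice.Build d Q bq_meetP.
HB.instance Definition _ := Order.POrder_isJoinSemilattice.Build d Q bq_joinP.

Lemma bool_quot_meetE (x y : A) : cl x `&` cl y = cl (pb_meet x y).
Proof.
apply: le_anti; apply/andP; split.
  rewrite bool_quot_leE pb_meetP -!bool_quot_leE.
  by rewrite leIl leIr.
rewrite lexI !bool_quot_leE.
by rewrite -pb_meetP.
Qed.

Lemma bool_quot_joinE (x y : A) : cl x `|` cl y = cl (pb_join x y).
Proof.
apply: le_anti; apply/andP; split.
  rewrite leUx !bool_quot_leE.
  by rewrite -pb_joinP.
rewrite bool_quot_leE pb_joinP -!bool_quot_leE.
by rewrite leUl leUr.
Qed.

Let bq_distr : left_distributive (@Order.meet d Q) (@Order.join d Q).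
Proof.
move=> x y z; apply: le_anti; apply/andP; split; last first.
  by rewrite leUx !leI2 ?leUl ?leUr.
rewrite -[x]reprK -[y]reprK -[z]reprK.
move: (repr x) (repr y) (repr z) => a b c.
by rewrite (bool_quot_joinE a b) !bool_quot_meetE bool_quot_joinE bool_quot_leE pb_distr.
Qed.

HB.instance Definition _ := Order.Lattice_Meet_isDistrLattice.Build d Q bq_distr.

Let bq_botP x : cl (pb_bot A) <= x.
Proof. by rewrite -[x]reprK bool_quot_leE pb_botP. Qed.
Let bq_topP x : x <= cl (pb_top A).
Proof. by rewrite -[x]reprK bool_quot_leE pb_topP. Qed.

HB.instance Definition _ := Order.hasBottom.Build d Q bq_botP.
HB.instance Definition _ := Order.hasTop.Build d Q bq_topP.

Let bq_compl (x : Q) : Q := cl (pb_compl (repr x)).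

Let bq_joinxC x : x `|` bq_compl x = \top.
Proof.
apply: le_anti; rewrite lex1 /= -{1}[x]reprK bool_quot_joinE.
by rewrite bool_quot_leE pb_joinC.
Qed.

Let bq_meetxC x : x `&` bq_compl x = \bot.
Proof.
apply: le_anti; rewrite le0x andbT -{1}[x]reprK bool_quot_meetE.
by rewrite bool_quot_leE pb_meetC.
Qed.

HB.instance Definition _ :=
  Order.TBDistrLattice_hasComplement.Build d Q bq_joinxC bq_meetxC.

End BooleanQuotient.

Section SetQuotient.
Variables (T : Type) (I : set (set T)).
Hypotheses (I0 : I set0) (IS : forall A B, A `<=` B -> I B -> I A)
  (IU : forall A B, I A -> I B -> I (A `|` B)).
Implicit Types A B D : set T.

Definition si_le A B : bool := `[< I (A `\` B) >].
Definition si_eqv A B : bool := `[< I ((A `\` B) `|` (B `\` A)) >].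

Let si_eqvE A B : si_eqv A B = si_le A B && si_le B A.
Proof.
apply/asboolP/andP => [h|[/asboolP AB /asboolP BA]]; last exact: IU.
by split; apply/asboolP; apply: IS h => x; [left|right].
Qed.

Let si_leS A B : A `<=` B -> si_le A B.
Proof. by move=> AB; apply/asboolP; have -> : A `\` B = set0 by rewrite setD_eq0. Qed.

Let si_trans : transitive si_le.
Proof.
move=> B A D /asboolP AB /asboolP BD; apply/asboolP; apply: IS (IU AB BD).
by move=> x [Ax nDx]; case: (pselect (B x)) => [Bx|nBx]; [right|left].
Qed.

Let si_meetP A B D : si_le A (B `&` D) = si_le A B && si_le A D.
Proof.
apply/idP/andP => [h|[/asboolP AB /asboolP AD]].
  by split; apply: si_trans h _; apply: si_leS => x [].
apply/asboolP; apply: IS (IU AB AD) => x [Ax /not_andP[nB|nD]]; [left|right];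
  by split.
Qed.

Let si_joinP A B D : si_le (A `|` B) D = si_le A D && si_le B D.
Proof.
apply/idP/andP => [h|[/asboolP AD /asboolP BD]].
  by split; apply: si_trans h; apply: si_leS => x; [left|right].
by apply/asboolP; apply: IS (IU AD BD) => x [[Ax|Bx] nD]; [left|right].
Qed.

Let si_equiv : equiv_class_of si_eqv.
Proof.
split.
- by move=> A; rewrite si_eqvE andbb si_leS.
- by move=> A B; rewrite !si_eqvE andbC.
- move=> B A D; rewrite !si_eqvE => /andP[AB BA] /andP[BD DB].
  by rewrite (si_trans AB BD) (si_trans DB BA).
Qed.

Let si_distr A B D :
  si_le ((A `|` B) `&` D) ((A `&` D) `|` (B `&` D)).
Proof. by rewrite setIUl si_leS. Qed.

Let si_botP A : si_le set0 A.
Proof. by rewrite si_leS. Qed.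
Let si_topP A : si_le A setT.
Proof. by rewrite si_leS. Qed.
Let si_joinC A : si_le setT (A `|` ~` A).
Proof. by rewrite setUv si_leS. Qed.
Let si_meetC A : si_le (A `&` ~` A) set0.
Proof. by rewrite setICr si_leS. Qed.

Definition set_preBoolean : preBoolean :=
  @PreBoolean (set T) (EquivRelPack si_equiv) si_le setI setU setC set0 setT
    si_eqvE si_trans si_meetP si_joinP si_distr si_botP si_topP si_joinC si_meetC.

End SetQuotient.

(* P(omega ^ C) / I_(omega ^ C); for C = 0 this is the two-element algebra. *)
Definition P_mod_I (C : ordinalType) : ctbDistrLatticeType set_display :=
  bool_quot set_display
    (set_preBoolean (@nonembedding0 C) (@nonembeddingS C) (@nonembeddingU C)).

Section ReducedPower.
Variables (d : Order.disp_t) (B : ctbDistrLatticeType d).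
Implicit Types b c e : nat -> B.

Definition rp_le b c : bool := `[< finite_set [set i | ~~ (b i <= c i)] >].
Definition rp_eqv b c : bool := `[< finite_set [set i | b i != c i] >].

Let finiteS (U V : set nat) : U `<=` V -> finite_set V -> finite_set U.
Proof. exact: sub_finite_set. Qed.

Let finiteU (U V : set nat) : finite_set U -> finite_set V -> finite_set (U `|` V).
Proof. by move=> hU hV; rewrite finite_setU. Qed.

Let rp_leT b c : (forall i, b i <= c i) -> rp_le b c.
Proof.
by move=> bc; apply/asboolP; rewrite (_ : mkset _ = set0) // -subset0 => i /=;
  rewrite bc.
Qed.

Let rp_eqvE b c : rp_eqv b c = rp_le b c && rp_le c b.
Proof.
apply/asboolP/andP => [h|[/asboolP bc /asboolP cb]].
  by split; apply/asboolP; apply: finiteS h => i /=; apply: contraNneq => ->.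
apply: finiteS (finiteU bc cb) => i /= bci.
by apply/orP; rewrite -negb_and; apply: contraNN bci; rewrite -eq_le.
Qed.

Let rp_trans : transitive rp_le.
Proof.
move=> c b e /asboolP bc /asboolP ce; apply/asboolP.
apply: finiteS (finiteU bc ce) => i /= bei; apply/orP; rewrite -negb_and.
by apply: contraNN bei => /andP[]; exact: le_trans.
Qed.

Let rp_equiv : equiv_class_of rp_eqv.
Proof.
split.
- by move=> b; rewrite rp_eqvE andbb rp_leT.
- by move=> b c; rewrite !rp_eqvE andbC.
- move=> c b e; rewrite !rp_eqvE => /andP[bc cb] /andP[ce ec].
  by rewrite (rp_trans bc ce) (rp_trans ec cb).
Qed.

Let meet b c : nat -> B := fun i => b i `&` c i.
Let join b c : nat -> B := fun i => b i `|` c i.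
Let compl b : nat -> B := fun i => ~` b i.

Let rp_meetP b c e : rp_le b (meet c e) = rp_le b c && rp_le b e.
Proof.
apply/idP/andP => [h|[/asboolP bc /asboolP be]].
  by split; apply: rp_trans h _; apply: rp_leT => i; rewrite ?leIl ?leIr.
apply/asboolP; apply: finiteS (finiteU bc be) => i /=.
by rewrite lexI negb_and => /orP.
Qed.

Let rp_joinP b c e : rp_le (join b c) e = rp_le b e && rp_le c e.
Proof.
apply/idP/andP => [h|[/asboolP bc /asboolP be]].
  by split; apply: rp_trans h; apply: rp_leT => i; rewrite ?leUl ?leUr.
apply/asboolP; apply: finiteS (finiteU bc be) => i /=.
by rewrite leUx negb_and => /orP.
Qed.

Let rp_distr b c e : rp_le (meet (join b c) e) (join (meet b e) (meet c e)).
Proof. by apply: rp_leT => i; rewrite /meet /join meetUl. Qed.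

Let rp_botP b : rp_le (fun=> \bot) b.
Proof. by apply: rp_leT => i; rewrite le0x. Qed.
Let rp_topP b : rp_le b (fun=> \top).
Proof. by apply: rp_leT => i; rewrite lex1. Qed.
Let rp_joinC b : rp_le (fun=> \top) (join b (compl b)).
Proof. by apply: rp_leT => i; rewrite /join joinxC. Qed.
Let rp_meetC b : rp_le (meet b (compl b)) (fun=> \bot).
Proof. by apply: rp_leT => i; rewrite /meet meetxC. Qed.

Definition rp_preBoolean : preBoolean :=
  @PreBoolean (nat -> B) (EquivRelPack rp_equiv) rp_le meet join compl
    (fun=> \bot) (fun=> \top)
    rp_eqvE rp_trans rp_meetP rp_joinP rp_distr rp_botP rp_topP rp_joinC rp_meetC.

Definition rp : ctbDistrLatticeType d := bool_quot d rp_preBoolean.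

End ReducedPower.

Definition nonzero d (B : ctbDistrLatticeType d) : Type := {b : B | b != \bot}.

HB.instance Definition _ d (B : ctbDistrLatticeType d) := SubChoice.on (nonzero B).
HB.instance Definition _ d (B : ctbDistrLatticeType d) :=
  [SubChoice_isSubPOrder of nonzero B by <: with d].

Section SeparativeQuotient.
Variables (d : Order.disp_t) (P : porderType d).
Implicit Types p q r s : P.

Definition le_star p q : bool :=
  `[< forall r, r <= p -> exists2 s, s <= r & s <= q >].
Definition eq_star p q : bool := le_star p q && le_star q p.

Lemma le_star_refl : reflexive le_star.
Proof. by move=> p; apply/asboolP => r rp; exists r. Qed.

Lemma le_star_trans : transitive le_star.
Proof.
move=> q p t /asboolP pq /asboolP qt; apply/asboolP => r /pq [s sr /qt [u us ut]].
by exists u => //; exact: le_trans sr.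
Qed.

Fact eq_star_equiv : equiv_class_of eq_star.
Proof.
split.
- by move=> p; rewrite /eq_star le_star_refl.
- by move=> p q; rewrite /eq_star andbC.
- move=> q p t /andP[pq qp] /andP[qt tq].
  by rewrite /eq_star (le_star_trans pq qt) (le_star_trans tq qp).
Qed.

Canonical eq_star_equiv_rel := EquivRelPack eq_star_equiv.

Definition sq : Type := {eq_quot eq_star}%qT.

HB.instance Definition _ := Choice.on sq.
HB.instance Definition _ : EqQuotient _ eq_star sq := EqQuotient.on sq.

Definition sq_le (x y : sq) : bool := le_star (repr x) (repr y).

Fact sq_le_refl : reflexive sq_le.
Proof. by move=> x; exact: le_star_refl. Qed.

Fact sq_le_anti : antisymmetric sq_le.
Proof.
move=> x y xy; have : eq_star (repr x) (repr y) by [].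
by rewrite -eqmodE !reprK => /eqP.
Qed.

Fact sq_le_trans : transitive sq_le.
Proof. by move=> y x z; exact: le_star_trans. Qed.

HB.instance Definition _ :=
  Order.Le_isPOrder.Build d sq sq_le_refl sq_le_anti sq_le_trans.

Lemma sq_leE p q : (\pi_sq%qT p <= \pi_sq%qT q :> sq) = le_star p q.
Proof.
have reprP (t : P) : eq_star (repr (\pi_sq%qT t : sq)) t.
  by rewrite -eqmodE reprK.
have /andP[p1 p2] := reprP p; have /andP[q1 q2] := reprP q.
apply/idP/idP => h.
- exact: le_star_trans (le_star_trans p2 h) q1.
- exact: le_star_trans (le_star_trans p1 h) q2.
Qed.

End SeparativeQuotient.

Definition poset_prod d (I : Type) (P : I -> porderType d) : Type := forall i, P i.

HB.instance Definition _ d I (P : I -> porderType d) :=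
  Choice.copy (poset_prod P) (forall i, P i).

Section PosetProduct.
Variables (d : Order.disp_t) (I : Type) (P : I -> porderType d).
Implicit Types x y z : poset_prod P.

Definition poset_prod_le x y : bool := `[< forall i, x i <= y i >].

Fact poset_prod_le_refl : reflexive poset_prod_le.
Proof. by move=> x; apply/asboolP. Qed.

Fact poset_prod_le_anti : antisymmetric poset_prod_le.
Proof.
move=> x y /andP[/asboolP xy /asboolP yx].
by apply: functional_extensionality_dep => i; apply: le_anti; rewrite xy yx.
Qed.

Fact poset_prod_le_trans : transitive poset_prod_le.
Proof.
move=> y x z /asboolP xy /asboolP yz; apply/asboolP => i.
exact: le_trans (xy i) (yz i).
Qed.

HB.instance Definition _ := Order.Le_isPOrder.Build d (poset_prod P)
  poset_prod_le_refl poset_prod_le_anti poset_prod_le_trans.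

End PosetProduct.

Definition poset_pow d (P : porderType d) (s : nat) : porderType d :=
  poset_prod (fun _ : 'I_s => P).

(* Main.v *)
(** Write alpha as a finite non-increasing sum of indecomposable blocks
    [omega ^ delta_j], the tail [k] being [k] blocks [omega ^ 0].  A self-embedding
    of alpha sends a large part of each block into a single block, which cannot
    come earlier; since distinct blocks go to distinct blocks, each goes to
    itself.  So a subset of alpha is a copy iff its trace on every block is large
    (contains a copy of the block), and [A <=* B] iff every trace of [A \ B] is
    small, whence [sq (P(alpha))] is the product of the posets
    [(P(omega ^ delta_j) / I)^+], the tail contributing one-point factors.
    Finally [omega ^ (delta + 1)] is a sum of omega many blocks [omega ^ delta],
    and a subset of it is small iff only finitely many of its traces are not,
    which gives [P(omega ^ (delta + 1)) / I = rp (P(omega ^ delta) / I)]. *)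

Require Import Defs.
From HB Require Import structures.
From mathcomp Require Import all_boot all_order.
From mathcomp Require Import generic_quotient finmap.
From mathcomp Require Import mathcomp_extra boolp classical_sets functions cardinality.

Set Implicit Arguments.
Unset Strict Implicit.
Unset Printing Implicit Defensive.

Import Order.TTheory.

Local Open Scope classical_set_scope.
Local Open Scope order_scope.

(** * Large sets and copies *)

Definition large (X : ordinalType) (A : set X) : Prop :=
  exists2 f : X -> X, {homo f : x y / x < y} & forall x, A (f x).

Lemma nonembeddingE (X : ordinalType) (A : set X) :
  nonembedding A <-> ~ large A.
Proof.
split=> nA => [[f fh fA]|[f [fm fA]]]; apply: nA; exists f.
- by split; [exact: le_mono|move=> _ [x _ <-]].
- by move=> x y; rewrite (leW_mono fm).
- by move=> x; apply: fA; exists x.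
Qed.

Lemma largeS (X : ordinalType) (A B : set X) : A `<=` B -> large A -> large B.
Proof. by move=> AB [f fh fA]; exists f => // x; exact: AB. Qed.

Section Copies.
Variables (X : ordinalType) (A : set X).

(* The increasing enumeration of A; it is defined everywhere as soon as some
   strictly increasing f maps X into A, because then [enum y <= f y]. *)
Let above (y : X) (e : forall z : X, z < y -> X) : set X :=
  [set s | A s /\ forall z (zy : z < y), e z zy < s].

Let step (y : X) (e : forall z : X, z < y -> X) : X :=
  xget y [set s | above e s /\ forall t, above e t -> s <= t].

Let enum : X -> X := Fix (@lt_wf _ X) (fun=> X) step.

Let enumE y : enum y = step (fun z (_ : z < y) => enum z).
Proof.
apply: (Fix_eq (@lt_wf _ X) (fun=> X) step) => x f g fg.
by congr step; apply: functional_extensionality_dep => z;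
  apply: functional_extensionality_dep.
Qed.

(** The enumeration exhausts A because it never falls below its argument: every [s] in A satisfies
    [s <= enum s], and the least [y] with [s <= enum y] enumerates [s]. *)
Lemma is_copyE : is_copy A <-> large A.
Proof.
split=> [[f [[fA _ _] fm]]|[f fh fA]].
  by exists f => [|x]; [move=> x y; rewrite (leW_mono fm)|exact: fA].
have enumP y : [/\ A (enum y), forall z, z < y -> enum z < enum y &
    forall t, A t -> (forall z, z < y -> enum z < t) -> enum y <= t].
  (* The bound by [f y] is carried through the induction, since it shows that A has an element above
     all earlier values of [enum]. *)
  suff [] : [/\ A (enum y), forall z, z < y -> enum z < enum y,
      forall t, A t -> (forall z, z < y -> enum z < t) -> enum y <= t &
      enum y <= f y] by [].
  elim/(well_founded_ind (@lt_wf _ X)): y => y IH.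
  have fy z : z < y -> enum z < f y.
    by move=> zy; have [_ _ _ /le_lt_trans->] := IH z zy; rewrite ?fh.
  have [s [[As ys] smin]] : exists s, (A s /\ forall z, z < y -> enum z < s) /\
      forall t, A t /\ (forall z, z < y -> enum z < t) -> s <= t.
    by apply: ordinal_least; exists (f y); split=> //; exact: fA.
  have sE : enum y = s.
    rewrite enumE /step; case: xgetP => [t -> [h1 h2]|/(_ s)].
      by apply: le_anti; rewrite h2 ?smin.
    by case; split=> // t; exact: smin.
  rewrite sE; split=> // [t At yt|]; first exact: smin.
  by apply: smin; split=> //; exact: fA.
have eh : {homo enum : x y / x < y}.
  by move=> x y xy; have [_ -> ] := enumP y.
exists enum; split; last exact: le_mono.
split=> [y _|y y' _ _ /(inc_inj (le_mono eh))//|s As].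
  by have [] := enumP y.
have [y [sy ymin]] : exists y, s <= enum y /\ forall z, s <= enum z -> y <= z.
  by apply: ordinal_least; exists s; exact: ordinal_homo_ge.
exists y => //; apply: le_anti; rewrite sy andbT.
have [_ _ -> //] := enumP y => z zy.
by rewrite ltNge; apply/negP => /ymin; rewrite leNgt zy.
Qed.

End Copies.

(** * Indecomposable order types *)

(** The partition property of the powers of omega. Nonemptiness excludes the ordinal 0, for which
    the second clause holds trivially. *)
Definition indecomposable (W : ordinalType) : Prop :=
  (exists w : W, True) /\
  forall S T : set W, (forall w, S w \/ T w) -> large S \/ large T.

Lemma indecomposable_omega_pow (C : ordinalType) : indecomposable (omega_pow C).
Proof.
split=> [|S T /omega_pow_indecomposable[f [fh []fS]]].
- by exists (opow0 C).
- by left; exists f.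
- by right; exists f.
Qed.

Lemma fin_ordinal1_lt (x y : fin_ordinal 1) : (x < y) = false.
Proof.
by have -> : x = y; [rewrite (ord1 (x : 'I_1)) (ord1 (y : 'I_1))|rewrite ltxx].
Qed.

Lemma indecomposable1 : indecomposable (fin_ordinal 1).
Proof.
pose o : fin_ordinal 1 := (ord0 : 'I_1).
split=> [|S T /(_ o) STo]; first by exists o.
by case: STo; [left|right]; exists (fun=> o) => // x y; rewrite fin_ordinal1_lt.
Qed.

Lemma indecomposable_setU (W : ordinalType) (A B : set W) :
  indecomposable W -> large (A `|` B)%classic -> large A \/ large B.
Proof.
move=> [_ Wi] [f fh fAB].
have [[g gh gA]|[g gh gB]] := Wi (f @^-1` A) (f @^-1` B) fAB; [left|right];
  by exists (f \o g) => // x y xy; apply/fh/gh.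
Qed.

(** Either the first colour class is large, or W embeds into the points coloured from the rest of
    the list, and the induction applies to the colouring pulled back along that embedding. *)
Lemma indecomposable_seq (W : ordinalType) (J : eqType) (s : seq J) (c : W -> J) :
  indecomposable W -> (forall w, c w \in s) -> exists j, large [set w | c w = j].
Proof.
move=> [[w0 _] Wi]; elim: s c => [|j s IH] c cs; first by have := cs w0.
have [|lj|[f fh fs]] := Wi [set w | c w = j] [set w | c w \in s].
- by move=> w; have := cs w; rewrite inE => /orP[/eqP|]; [left|right].
- by exists j.
- have [i [g gh gi]] := IH (c \o f) fs.
  by exists i, (f \o g) => // x y xy; apply/fh/gh.
Qed.

(** * Decompositions into blocks *)

(* X is cut into the intervals [b @^-1` [set j]], of order type [W j]; since the
   blocks are nonempty in the applications, [prec] is then automatically a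
   strict order, and only its totality is ever assumed. *)
Definition blocks (X : ordinalType) (J : Type) (prec : J -> J -> Prop)
    (W : J -> ordinalType) (b : X -> J) : Prop :=
  (forall x y, prec (b x) (b y) -> x < y) /\
  forall j, exists2 e : W j -> X, {homo e : v w / v < w} &
    forall x, b x = j <-> exists w, e w = x.

Section Blocks.
Variables (X : ordinalType) (J : Type) (prec : J -> J -> Prop).
Variables (W : J -> ordinalType) (b : X -> J).
Hypothesis bW : blocks prec W b.

Definition block_emb j : W j -> X := projT1 (cid2 (bW.2 j)).
Local Notation e := block_emb.

Lemma block_emb_homo j : {homo @e j : v w / v < w}.
Proof. by rewrite /e; case: cid2. Qed.

Lemma block_emb_inj j : injective (@e j).
Proof. exact/inc_inj/le_mono/block_emb_homo. Qed.

Lemma block_index j (w : W j) : b (e w) = j.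
Proof. by rewrite /e; case: cid2 => f /= fh fb; apply/fb; exists w. Qed.

Lemma block_ex x : exists j (w : W j), x = e w.
Proof.
exists (b x); rewrite /e; case: cid2 => f fh fb /=.
by have /fb[w wx] := erefl (b x); exists w.
Qed.

Lemma block_lift (Y : ordinalType) (u : Y -> X) j :
  {homo u : x y / x < y} -> (forall y, b (u y) = j) ->
  exists2 v : Y -> W j, {homo v : x y / x < y} & forall y, u y = e (v y).
Proof.
move=> uh uj; have /choice[v vE] : forall y, exists v : W j, u y = e v.
  move=> y; have [i [w uE]] := block_ex (u y).
  by move: (uj y); rewrite uE block_index => ij; subst i; exists w.
exists v => // x y xy; rewrite -(leW_mono (le_mono (@block_emb_homo j))).
by rewrite -!vE; exact: uh.
Qed.

Lemma block_lt j j' (w : W j) (w' : W j') : prec j j' -> e w < e w'.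
Proof. by move=> h; apply: bW.1; rewrite !block_index. Qed.

(** A point of X determines its block and its position there, so values on the blocks can be
    prescribed independently. *)
Lemma block_glue (Y : Type) (F : forall j, W j -> Y) :
  exists f : X -> Y, forall j (w : W j), f (e w) = F j w.
Proof.
suff /choice[f fP] : forall x, exists y, forall j (w : W j), e w = x -> y = F j w.
  by exists f => j w; exact: fP.
move=> x; have [j [w ->]] := block_ex x; exists (F j w) => j' w' ww'.
have jj' : j = j' by rewrite -(block_index w) -ww' block_index.
by subst j'; rewrite (block_emb_inj ww').
Qed.

Lemma block_glue_set (S : forall j, set (W j)) :
  exists A : set X, forall j, @e j @^-1` A = S j.
Proof.
have [A AS] := block_glue S; exists A => j.
by apply/funext => w; rewrite /preimage /= AS.
Qed.

Hypothesis prec_total : forall i j, [\/ prec i j, i = j | prec j i].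

(** Points of different blocks are compared by their blocks, whose order [f] preserves, and points
    of block [j] by [F j]; so the glued map is increasing. *)
Lemma block_homo (f : J -> J) (F : forall j, W j -> W (f j)) (A : set X) :
  (forall i j, prec i j -> prec (f i) (f j)) ->
  (forall j, {homo F j : v w / v < w}) ->
  (forall j w, A (e (F j w))) -> large A.
Proof.
move=> fp Fh FA; have [g gE] := block_glue (fun j w => e (F j w)).
exists g => [x y|x]; last by have [j [w ->]] := block_ex x; rewrite gE.
have [i [v ->]] := block_ex x; have [j [w ->]] := block_ex y; rewrite !gE.
case: (prec_total i j) => [/fp h _|ij|ji].
- exact: block_lt.
- subst j; rewrite (leW_mono (le_mono (@block_emb_homo i))) => vw.
  exact/block_emb_homo/Fh.
- by move=> vw; have := lt_trans vw (block_lt w v ji); rewrite ltxx.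
Qed.

End Blocks.
Arguments block_emb {X J prec W b} bW j w.

(** * Large sets in a finite sum of blocks *)

Section FiniteBlocks.
Variables (X : ordinalType) (J : finType) (prec : J -> J -> Prop).
Variables (W : J -> ordinalType) (b : X -> J).
Hypothesis bW : blocks prec W b.
Hypothesis prec_total : forall i j, [\/ prec i j, i = j | prec j i].
Hypothesis Wi : forall j, indecomposable (W j).
(** The Cantor normal form condition: block types do not increase. *)
Hypothesis Wemb : forall i j, prec i j ->
  exists f : W j -> W i, {homo f : v w / v < w}.
Local Notation e := (block_emb bW).

Let prec_irr j : ~ prec j j.
Proof. by have [[w _] _] := Wi j => /(block_lt bW w w); rewrite ltxx. Qed.

Let prec_trans i j k : prec i j -> prec j k -> prec i k.
Proof.
have [[u _] _] := Wi i; have [[v _] _] := Wi j; have [[w _] _] := Wi k.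
move=> ij jk; have uw := lt_trans (block_lt bW u v ij) (block_lt bW v w jk).
case: (prec_total i k) => // [ik|/(block_lt bW w u)].
- by subst k; have := lt_trans (block_lt bW u v ij) (block_lt bW v u jk); rewrite ltxx.
- by move=> /(lt_trans uw); rewrite ltxx.
Qed.

(** Induction on the number of indices above [j]: if [j] moved up, [f j] would have fewer and hence
    be fixed, while monotonicity puts [f (f j)] strictly above [f j]. *)
Let increasing_id (f : J -> J) :
  (forall j, f j = j \/ prec j (f j)) ->
  (forall i j, prec i j -> prec (f i) (f j)) -> forall j, f j = j.
Proof.
move=> fge fh; pose up j : pred J := fun i => `[< prec j i >].
suff main m j : (#|up j| < m)%N -> f j = j.
  by move=> j; exact: main (ltnSn _).
elim: m j => // m IH j; rewrite ltnS => jm; case: (fge j) => // jfj.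
have ffj : f (f j) = f j.
  apply: IH; apply: leq_trans jm; apply: proper_card; apply/properP; split.
    apply/fintype.subsetP => i; rewrite !unfold_in => /asboolP fji.
    apply/asboolP; exact: prec_trans jfj fji.
  by exists (f j); rewrite unfold_in; [exact/asboolP|apply/asboolP; exact: prec_irr].
by have := fh _ _ jfj; rewrite ffj => /prec_irr.
Qed.

(** From right to left, embeddings of the blocks are glued. From left to right, [phi j] is a block
    receiving a large part of block [j]; as [phi] is increasing and moves nothing down, it is the
    identity. *)
Lemma large_blocks (A : set X) : large A <-> forall j, large (e j @^-1` A).
Proof.
split=> [[f fh fA]|lA]; last first.
  apply: (@block_homo _ _ _ _ _ bW prec_total id
    (fun j => projT1 (cid2 (lA j)))) => // j; by case: cid2.
have split_ j : exists i (g : W j -> W j) (v : W j -> W i),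
    [/\ {homo g : x y / x < y}, {homo v : x y / x < y} &
        forall w, f (e j (g w)) = e i (v w)].
  have [|i [g gh gi]] := @indecomposable_seq (W j) J (fintype.enum J)
    (fun w => b (f (e j w))) (Wi j); first by move=> w; rewrite mem_enum.
  have [|v vh gv] := @block_lift _ _ _ _ _ bW _ (fun w => f (e j (g w))) i _ gi.
    by move=> x y xy; apply/fh/block_emb_homo/gh.
  by exists i, g, v.
pose phi j := projT1 (cid (split_ j)).
have phiP j : exists (g : W j -> W j) (v : W j -> W (phi j)),
    [/\ {homo g : x y / x < y}, {homo v : x y / x < y} &
        forall w, f (e j (g w)) = e _ (v w)].
  by rewrite /phi; case: cid.
(* A self-embedding of a well-order moves no point down, so no part of block [j] lands in an earlier
   block. *)
have phi_ge j : phi j = j \/ prec j (phi j).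
  have [g [v [gh vh gv]]] := phiP j; have [[w _] _] := Wi j.
  case: (prec_total j (phi j)) => [||/(block_lt bW (v w) (g w))]; [by right|by left|].
  by rewrite -gv ltNge ordinal_homo_ge.
have phi_id := increasing_id phi_ge.
have {}phi_id : forall j, phi j = j.
  apply: phi_id => i j ij.
  have [g [v [gh vh gv]]] := phiP i; have [g' [v' [gh' vh' gv']]] := phiP j.
  have [[w' _] _] := Wi j.
  have lt_y w : e _ (v w) < e _ (v' w').
    by rewrite -gv -gv'; apply/fh/block_lt.
  case: (prec_total (phi i) (phi j)) => // [ijE|ji]; last first.
    have [[w _] _] := Wi i.
    by have := lt_trans (lt_y w) (block_lt bW (v' w') (v w) ji); rewrite ltxx.
  have [m mh] : exists m : W (phi i) -> W i, {homo m : x y / x < y}.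
    by case: (phi_ge i) => [->|/Wemb//]; exists id.
  (* The image of block i is cofinal in block [phi i] = [phi j], as W (phi i)
     embeds in W i, so nothing of block j can be mapped above it. *)
  move: (v' w') lt_y; rewrite -ijE => t /(_ (m t)).
  rewrite (leW_mono (le_mono (@block_emb_homo _ _ _ _ _ bW _))).
  rewrite ltNge => /negP[]; apply: (@ordinal_homo_ge _ (v \o m)) => x y /mh.
  exact: vh.
move=> j; have [g [v [gh vh gv]]] := phiP j.
move: v vh gv; rewrite phi_id => v vh gv.
by exists v => // w; rewrite /preimage /= -gv; exact: fA.
Qed.

End FiniteBlocks.

(** * Sums of omega many equal blocks *)

Section NatBlocks.
Variables (X W : ordinalType) (b : X -> nat).
Hypothesis bW : blocks (fun m n : nat => (m < n)%N) (fun=> W) b.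
Hypothesis Wi : indecomposable W.
Local Notation e := (block_emb bW).

(** An embedding sends a large part of block [N] into a single block, not an earlier one.
    Conversely, block [k] is embedded into the [k]-th term of an increasing sequence of blocks with
    large traces. *)
Lemma large_nat_blocks (A : set X) :
  large A <-> forall N, exists2 m, (N <= m)%N & large (e m @^-1` A).
Proof.
have [[w0 _] _] := Wi.
split=> [[f fh fA] N|lA].
  (* The image of block [N] lies below the image of a point of the next block, so it meets only
     finitely many blocks. *)
  have [|m [g gh gm]] := @indecomposable_seq W nat (iota 0 (b (f (e N.+1 w0))).+1)
    (fun w => b (f (e N w))) Wi.
    move=> w; rewrite mem_iota /= add0n ltnS leqNgt; apply/negP => lt_b.
    have := bW.1 _ _ lt_b; rewrite ltNge => /negP[].
    by apply/ltW/fh/block_lt.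
  have [|v vh gv] := @block_lift _ _ _ _ _ bW _ (fun w => f (e N (g w))) m _ gm.
    by move=> x y xy; apply/fh/block_emb_homo/gh.
  exists m; last by exists v => // w; rewrite /preimage /= -gv.
  rewrite leqNgt; apply/negP => /(block_lt bW (v w0) (g w0)).
  by rewrite -gv ltNge ordinal_homo_ge.
have [h hge hl] : exists2 h : nat -> nat, forall N, (N <= h N)%N &
    forall N, large (e (h N) @^-1` A).
  have /choice[h hP] : forall N, exists m, (N <= m)%N /\ large (e m @^-1` A).
    by move=> N; have [m] := lA N; exists m.
  by exists h => N; have [] := hP N.
(* As [N <= h N], taking [h] of the successor of the previous index makes [s] strictly
   increasing. *)
pose s := fix s k := if k is k'.+1 then h (s k').+1 else h 0%N.
have sl k : large (e (s k) @^-1` A) by case: k => [|k]; exact: hl.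
have sh : {homo s : i j / (i < j)%N} by apply: homo_ltn ltn_trans _ => i /=.
apply: (@block_homo _ _ _ _ _ bW _ s (fun k => projT1 (cid2 (sl k)))).
- by move=> i j; case: (ltngtP i j) => ?; [apply: Or31|apply: Or33|apply: Or32].
- exact: sh.
- by move=> k; case: cid2.
- by move=> k; case: cid2.
Qed.

(** A set of naturals is finite iff it is bounded; this matches the ideal with the finiteness clause
    in the order of [rp]. *)
Lemma nonembedding_nat_blocks (A : set X) :
  nonembedding A <-> finite_set [set m | ~ nonembedding (e m @^-1` A)].
Proof.
rewrite nonembeddingE large_nat_blocks; split.
  move=> /existsNP[N AN]; apply: sub_finite_set (finite_II N) => m /=.
  rewrite nonembeddingE ltnNge => /contrapT lm; apply/negP => Nm.
  by apply: AN; exists m.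
move=> /finite_seqP[s sE] lA; have [m sm lm] := lA (\max_(i <- s) i).+1.
have : m \in s.
  suff : [set` s] m by [].
  by rewrite -sE /= nonembeddingE; apply.
by move=> /(@leq_bigmax_seq _ _ xpredT id)/(_ isT); rewrite leqNgt sm.
Qed.

End NatBlocks.

(** * Presentations of the quotient algebras *)

(* B is isomorphic to P(W) / I_W. *)
Definition presents (W : ordinalType) d (B : ctbDistrLatticeType d) : Prop :=
  exists2 G : set W -> B,
    forall S T, (G S <= G T) = `[< nonembedding (S `\` T)%classic >] &
    forall c, exists S, G S = c.

Lemma presents_P_mod_I (C : ordinalType) : presents (omega_pow C) (P_mod_I C).
Proof.
exists (\pi_(P_mod_I C))%qT => [S T|c]; first exact: bool_quot_leE.
by exists (repr c); rewrite reprK.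
Qed.

(** A set is sent to the class of the sequence of its coded traces. A difference is small iff almost
    all its traces are, and gluing yields every sequence. *)
Lemma presents_rp (X W : ordinalType) (b : X -> nat) d (B : ctbDistrLatticeType d) :
  blocks (fun m n : nat => (m < n)%N) (fun=> W) b -> indecomposable W ->
  presents W B -> presents X (rp B).
Proof.
move=> bW Wi [G GE Gs].
exists (fun A => \pi_(rp B)%qT (fun m => G (block_emb bW m @^-1` A))) => [S T|c].
  rewrite bool_quot_leE; apply: asbool_equiv_eq.
  rewrite (nonembedding_nat_blocks bW Wi).
  have -> // : [set m | ~ nonembedding (block_emb bW m @^-1` (S `\` T)%classic)] =
      [set m | ~~ (G (block_emb bW m @^-1` S) <= G (block_emb bW m @^-1` T))].
  by apply/funext => m; apply/propext; rewrite /mkset GE; split=> /asboolPn.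
have /choice[S SE] : forall m, exists S, G S = (repr c : nat -> B) m.
  by move=> m; exact: Gs.
have [A AS] := block_glue_set bW S; exists A.
rewrite -[RHS]reprK; congr \pi_(rp B)%qT; apply/funext => m.
by rewrite AS SE.
Qed.

Lemma large_iso (X Y : ordinalType) (f : X -> Y) (A : set Y) :
  bijective f -> {homo f : x y / x < y} -> large A <-> large (f @^-1` A).
Proof.
move=> [g fK gK] fh; have fm := leW_mono (le_mono fh).
have gh : {homo g : x y / x < y} by move=> x y xy; rewrite -fm !gK.
split=> -[h hh hA].
- exists (g \o h \o f) => [x y xy|x]; first exact/gh/hh/fh.
  by rewrite /preimage /= gK.
- by exists (f \o h \o g) => [x y xy|x]; [exact/fh/hh/gh|exact: hA].
Qed.

Lemma presents_iso (X Y : ordinalType) (f : X -> Y) d (B : ctbDistrLatticeType d) :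
  bijective f -> {homo f : x y / x < y} -> presents X B -> presents Y B.
Proof.
move=> fb fh [G GE Gs]; exists (fun A => G (f @^-1` A)) => [S T|c].
  by rewrite GE; apply: asbool_equiv_eq; rewrite !nonembeddingE (large_iso _ fb fh).
have [g fK gK] := fb; have [S <-] := Gs c; exists (g @^-1` S).
by congr G; apply/funext => x; rewrite /preimage /= fK.
Qed.

(** * Powers of omega and iterated reduced powers *)

Lemma opow_of_fun (C : choiceType) (h : C -> nat) (s : seq C) :
  (forall x, h x != 0%N -> x \in s) -> exists f : opow C, f =1 h.
Proof.
move=> hs; exists [fsfun x in [fset x | x in s]%fset => h x] => x.
rewrite /fun_of_opow fsfunE; case: ifPn => // xs; apply/esym/eqP.
by apply: contraNT xs => /hs; rewrite !inE.
Qed.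

Section PowerExtension.
Variables (C D : ordinalType) (i : C -> D).
Hypothesis ih : {homo i : x y / x < y}.

Let im := leW_mono (le_mono ih).
Let ii := inc_inj (le_mono ih).

Lemma opow_extension : exists E : omega_pow C -> omega_pow D,
  forall f, (forall x, E f (i x) = f x) /\ forall y, ~ range i y -> E f y = 0%N.
Proof.
suff /choice[E EP] : forall f : omega_pow C, exists g : omega_pow D,
    (forall x, g (i x) = f x) /\ forall y, ~ range i y -> g y = 0%N by exists E.
move=> f.
have /choice[h hP] : forall y, exists m, (forall x, i x = y -> m = f x) /\
    (~ range i y -> m = 0%N).
  move=> y; case: (pselect (range i y)) => [[x _ <-]|ny].
    by exists (f x); split=> [z /ii->//|[]]; exists x.
  by exists 0%N; split=> // x xy; case: ny; exists x.
have [y hy|g gh] := @opow_of_fun D h (map i (enum_fset (finsupp f))).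
  case: (pselect (range i y)) => [[x _ xy]|/(hP y).2 h0]; last by rewrite h0 in hy.
  rewrite -xy map_f // mem_finsupp; have [/(_ x xy) hE _] := hP y.
  by rewrite hE in hy.
by exists g; split=> [x|y]; rewrite gh; [exact: (hP (i x)).1|exact: (hP y).2].
Qed.

Lemma opow_restriction (g : omega_pow D) :
  exists f : omega_pow C, forall x, f x = g (i x).
Proof.
have inv (s : seq D) : exists t : seq C, forall x, i x \in s -> x \in t.
  elim: s => [|y s [t st]]; first by exists [::].
  case: (pselect (range i y)) => [[x _ <-]|ny].
    by exists (x :: t) => z; rewrite !inE => /orP[/eqP/ii->|/st->]; rewrite ?eqxx ?orbT.
  by exists t => z; rewrite inE => /orP[/eqP zy|/st//]; case: ny; exists z.
have [t gt] := inv (enum_fset (finsupp g)).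
have [x gx|f fE] := @opow_of_fun C (g \o i) t; last by exists f.
by apply: gt; rewrite mem_finsupp.
Qed.

Lemma opow_extension_homo (E : omega_pow C -> omega_pow D) :
  (forall f, (forall x, E f (i x) = f x) /\ forall y, ~ range i y -> E f y = 0%N) ->
  {homo E : f g / f < g}.
Proof.
move=> EP f g; rewrite !omega_pow_ltE => /asboolP[x [fgx fg]]; apply/asboolP.
exists (i x); split=> [|y xy]; first by rewrite !(EP _).1.
case: (pselect (range i y)) => [[z _ zy]|ny]; last by rewrite !(EP _).2.
by rewrite -zy !(EP _).1 fg // -im zy.
Qed.

Lemma omega_pow_homo : exists E : omega_pow C -> omega_pow D, {homo E : f g / f < g}.
Proof. by have [E EP] := opow_extension; exists E; exact: opow_extension_homo. Qed.

Lemma presents_omega_pow_iso d (B : ctbDistrLatticeType d) :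
  (forall y, range i y) -> presents (omega_pow C) B -> presents (omega_pow D) B.
Proof.
move=> si; have [E EP] := opow_extension.
apply: presents_iso (opow_extension_homo EP).
have /choice[R RE] := opow_restriction; exists R => [f|g]; apply: opowP => x.
  by rewrite RE (EP _).1.
by have [z _ <-] := si x; rewrite (EP _).1 RE.
Qed.

Variable t : D.
Hypotheses (it : forall x, i x < t) (Dt : forall y, y = t \/ range i y).

(** As [t] is the greatest exponent, this is the identity
    $\omega^{\delta+1}=\omega^\delta\cdot\omega$: the coefficient at [t] numbers the block, and the
    other coefficients give the position in it. *)
Lemma blocks_omega_powS :
  blocks (fun m n : nat => (m < n)%N) (fun=> omega_pow C)
    (fun g : omega_pow D => g t).
Proof.
have tmax y : (t < y) = false.
  apply/negP; case: (Dt y) => [->|[x _ <-]]; rewrite ?ltxx //.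
  by move=> /(lt_trans (it x)); rewrite ltxx.
split=> [f g fg|m].
  by rewrite omega_pow_ltE; apply/asboolP; exists t; split=> // y; rewrite tmax.
have [E EP] := opow_extension.
exists (fun f => opow_set (E f) t m) => [f g|g].
  rewrite !omega_pow_ltE => /asboolP[x [fgx fg]]; apply/asboolP.
  exists (i x); rewrite !opow_setE (lt_eqF (it x)) !(EP _).1; split=> // y xy.
  rewrite !opow_setE; case: eqP => // yt; case: (Dt y) => [//|[z _ zy]].
  by rewrite -zy !(EP _).1 fg // -im zy.
split=> [gt|[f <-]]; last by rewrite opow_setE eqxx.
have [f fE] := opow_restriction g; exists f; apply: opowP => y.
rewrite opow_setE; case: eqP => [->//|yt]; case: (Dt y) => [//|[z _ <-]].
by rewrite (EP _).1 fE.
Qed.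

End PowerExtension.

(** Passing from [r] to [r.+1] adds one greatest exponent [t], which amounts to one more reduced
    power. *)
Lemma presents_iter_rp (C : ordinalType) (r : nat) :
  presents (omega_pow (oadd C (fin_ordinal r)))
    (iter r (@rp set_display) (P_mod_I C)).
Proof.
elim: r => [|r IH].
  apply: (@presents_omega_pow_iso C (oadd C (fin_ordinal 0)) inl).
  - by move=> x y xy; apply/asboolP.
  - by move=> [c|[[]//]]; exists c.
  - exact: presents_P_mod_I.
pose i (u : oadd C (fin_ordinal r)) : oadd C (fin_ordinal r.+1) :=
  match u with inl c => inl c | inr k => inr (widen_ord (leqnSn r) k) end.
pose t : oadd C (fin_ordinal r.+1) := inr (ord_max : 'I_r.+1).
apply: presents_rp IH; last exact: indecomposable_omega_pow.
apply: (@blocks_omega_powS _ _ i _ t).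
- by move=> [c|k] [c'|k'] /asboolP h;
    apply/asboolP => //; apply/asboolP; move/asboolP: h.
- by move=> [c|k]; apply/asboolP => //; apply/asboolP; exact: (ltn_ord (k : 'I_r)).
- move=> [c|k]; first by right; exists (inl c).
  case: (unliftP ord_max (k : 'I_r.+1)) => [k' kE|->]; last by left.
  right; exists (inr k') => //=; congr inr; apply: val_inj.
  by rewrite kE /= /bump leqNgt ltn_ord.
Qed.

(** * Block decompositions of sums and products *)

Lemma blocks_iso (X Y : ordinalType) (f : X -> Y) (J : Type) (prec : J -> J -> Prop)
    (W : J -> ordinalType) (b : Y -> J) :
  bijective f -> {mono f : x y / x <= y} -> blocks prec W b -> blocks prec W (b \o f).
Proof.
move=> [g fK gK] /leW_mono fm [bp be].
split=> [x y /bp|j]; first by rewrite fm.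
have [e eh ej] := be j; exists (g \o e) => [v w vw|x].
  by rewrite -fm /= !gK; exact: eh.
split=> [/ej[w wx]|[w <-]]; first by exists w; rewrite /= wx fK.
by apply/ej; exists w; rewrite /= gK.
Qed.

(** The normal form lists its exponents from the largest down, through [rev_ord]; this restores the
    original indices. *)
Lemma blocks_reindex (X : ordinalType) (J : Type) (prec : J -> J -> Prop)
    (W : J -> ordinalType) (b : X -> J) (s : J -> J) :
  involutive s -> blocks prec (W \o s) b ->
  blocks (fun i j => prec (s i) (s j)) W (s \o b).
Proof.
move=> sK [bp be]; split=> [x y /=|j]; first by rewrite !sK; exact: bp.
rewrite -[j]sK; have [e eh ej] := be (s j); exists e => // x.
by split=> [/(can_inj sK)/ej//|/ej <-].
Qed.

(** Each block is cut in turn; the pieces are compared first by outer block, then by rank. *)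
Lemma blocks_comp (X : ordinalType) (I : Type) (prec : I -> I -> Prop)
    (V : I -> ordinalType) (b : X -> I) (K : I -> Type) (rank : forall i, K i -> nat)
    (W : forall i, K i -> ordinalType) (c : forall i, V i -> K i) :
  blocks prec V b ->
  (forall i, blocks (fun k l => (rank i k < rank i l)%N) (W i) (c i)) ->
  exists bc : X -> {i : I & K i},
    blocks (fun u v => prec (tag u) (tag v) \/
      tag u = tag v /\ (rank _ (tagged u) < rank _ (tagged v))%N)
    (fun u => W _ (tagged u)) bc.
Proof.
move=> bV cW.
have [bc bcE] := block_glue bV (fun i v => Tagged K (c i v)).
exists bc; split=> [x y|[i k]].
  have [i [v ->]] := block_ex bV x; have [j [w ->]] := block_ex bV y.
  rewrite !bcE /= => -[ij|[ij]]; first exact: block_lt.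
  by subst j => /(cW i).1; exact: block_emb_homo.
exists (block_emb bV i \o block_emb (cW i) k) => [v w vw|x].
  by apply/block_emb_homo/block_emb_homo.
split=> [|[w <-]]; last by rewrite /= bcE block_index.
have [j [v ->]] := block_ex bV x; rewrite bcE /=.
have [l [w ->]] := block_ex (cW j) v; rewrite block_index => jl.
(* A predicate on pairs lets [jl] be rewritten in both components at once. *)
pose F (u : {i : I & K i}) := exists w' : W _ (tagged u),
  block_emb bV _ (block_emb (cW _) _ w') = block_emb bV j (block_emb (cW j) l w).
by have : F (Tagged K l) by [exists w]; rewrite jl.
Qed.

Lemma blocks_oadd (A B : ordinalType) (I J : Type)
    (precI : I -> I -> Prop) (precJ : J -> J -> Prop)
    (V : I -> ordinalType) (W : J -> ordinalType) (a : A -> I) (b : B -> J) :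
  blocks precI V a -> blocks precJ W b ->
  blocks (fun u v : I + J => match u, v with
      | inl i, inl i' => precI i i' | inl _, inr _ => True
      | inr _, inl _ => False | inr j, inr j' => precJ j j'
    end)
    (fun u => match u with inl i => V i | inr j => W j end)
    (fun x : oadd A B => match x with inl x => inl (a x) | inr y => inr (b y) end).
Proof.
move=> [ap ae] [bp be]; split.
- by move=> [x|x] [y|y] // h; apply/asboolP => //=; [exact: ap|exact: bp].
- move=> [i|j].
    have [e eh ei] := ae i; exists (inl \o e) => [v w /eh h|]; first exact/asboolP.
    move=> [x|y]; last by split=> [//|[w //]].
    by split=> [[]/ei[w <-]|[w [wx]]]; [exists w|congr inl; apply/ei; exists w].
  have [e eh ej] := be j; exists (inr \o e) => [v w /eh h|]; first exact/asboolP.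
  move=> [x|y]; first by split=> [//|[w //]].
  by split=> [[]/ej[w <-]|[w [wy]]]; [exists w|congr inr; apply/ej; exists w].
Qed.

Lemma blocks_big_oadd (m : nat) (F : 'I_m -> ordinalType) :
  exists b : (\big[oadd/(fin_ordinal 0 : ordinalType)]_(i < m) F i) -> 'I_m,
    blocks (fun i j : 'I_m => (i < j)%N) F b.
Proof.
elim: m F => [|m IH] F.
  rewrite big_ord0; exists (fun x : fin_ordinal 0 => x : 'I_0).
  by split=> [[]|[]].
have [b [bp be]] := IH (fun i => F (lift ord0 i)); rewrite big_ord_recl.
exists (fun x => match x with inl _ => ord0 | inr y => lift ord0 (b y) end).
split=> [[x|x] [y|y] //|i].
- by move=> _; exact/asboolP.
- rewrite /= /bump !leq0n !add1n ltnS => /bp xy; exact/asboolP.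
case: (unliftP ord0 i) => [j ->|->].
  have [e eh ej] := be j; exists (inr \o e) => [v w /eh h|]; first exact/asboolP.
  move=> [x|y]; first by split=> [/eqP|[w //]]; rewrite (negPf (neq_lift _ _)).
  split=> [/lift_inj/ej[w <-]|[w [wy]]]; first by exists w.
  by congr lift; apply/ej; exists w.
exists inl => [v w h|]; first exact/asboolP.
move=> [x|y]; first by split=> // _; exists x.
by split=> [/eqP|[w //]]; rewrite eq_sym (negPf (neq_lift _ _)).
Qed.

Lemma blocks_omul (W : ordinalType) (s : nat) :
  blocks (fun i j : 'I_s => (i < j)%N) (fun=> W)
    (fun u : omul W (fin_ordinal s) => (u : fin_ordinal s * W).1 : 'I_s).
Proof.
have fin_ltE (i j : fin_ordinal s) : (i < j) = ((i : 'I_s) < (j : 'I_s))%N.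
  by apply/asboolP/idP.
split=> [[i v] [j w] /= ij|j].
  by rewrite ltEprodlexi /= le_eqVlt fin_ltE ij orbT leNgt fin_ltE ij.
exists (fun w => (j, w) : omul W (fin_ordinal s)) => [v w vw|[i w]].
  by rewrite ltEprodlexi /= lexx.
by split=> [<-|[v [<-]]]; [exists w|].
Qed.

Lemma blocks_fin_ordinal (k : nat) :
  blocks (fun i j : 'I_k => (i < j)%N) (fun=> fin_ordinal 1 : ordinalType)
    (fun i : fin_ordinal k => i : 'I_k).
Proof.
split=> [i j ij|j]; first exact/asboolP.
exists (fun=> j : fin_ordinal k) => [v w|i]; first by rewrite fin_ordinal1_lt.
by split=> [->|[_ ->]] //; exists (ord0 : 'I_1).
Qed.

(** * Separative quotients and the order on copies *)

Section SqIso.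
Variables (d d' : Order.disp_t) (P : porderType d) (Q : porderType d').

(** [F] identifies exactly the [eq_star] equivalent elements; the inverse takes the class of any
    preimage. *)
Lemma sq_isomorphic (F : P -> Q) :
  (forall p q, (F p <= F q) = le_star p q) -> (forall y, exists p, F p = y) ->
  order_isomorphic (sq P) Q.
Proof.
move=> FE Fs; have [g gE] := choice Fs.
have rm : {mono (F \o repr : sq P -> Q) : x y / x <= y} by move=> x y; rewrite /= FE.
exists (F \o repr); split=> //; pose h y : sq P := \pi_(sq P)%qT (g y).
have hK : cancel h (F \o repr).
  move=> y; rewrite -[RHS]gE /=; apply: le_anti; rewrite !FE.
  by have : eq_star (repr (h y)) (g y) by rewrite -eqmodE reprK.
by exists h => // x; apply: (inc_inj rm); rewrite hK.
Qed.

End SqIso.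

Lemma le_copiesP (X : ordinalType) (A B : copies X) :
  reflect (val A `<=` val B) (A <= B).
Proof. by rewrite leEsub; apply: (iffP idP); rewrite subsetEset. Qed.

Section CopiesBlocks.
Variables (X : ordinalType) (J : finType) (prec : J -> J -> Prop).
Variables (W : J -> ordinalType) (b : X -> J).
Hypothesis bW : blocks prec W b.
Hypothesis prec_total : forall i j, [\/ prec i j, i = j | prec j i].
Hypothesis Wi : forall j, indecomposable (W j).
Hypothesis Wemb : forall i j, prec i j ->
  exists f : W j -> W i, {homo f : v w / v < w}.
Local Notation e := (block_emb bW).

Lemma copiesE (A : set X) : `[< is_copy A >] <-> forall j, large (e j @^-1` A).
Proof.
rewrite -(large_blocks bW prec_total Wi Wemb) -is_copyE.
by split=> /asboolP.
Qed.

Lemma le_star_copies (A B : copies X) :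
  le_star A B <->
  forall j, nonembedding (e j @^-1` (val A) `\` e j @^-1` (val B))%classic.
Proof.
have lA (C : copies X) := (copiesE (val C)).1 (valP C).
split=> [/asboolP AB j|AB].
  apply/nonembeddingE => lAB.
  (* B is removed from A inside block [j] only: that trace is the large difference and the others
     are those of A, so this is a copy, but no copy below it lies in B. *)
  pose C0 := (val A `\` (b @^-1` [set j] `&` val B))%classic.
  have /copiesE C0P : forall i, large (e i @^-1` C0).
    move=> i; case: (pselect (i = j)) => [->|ij].
      by apply: largeS lAB => w [Aw Bw]; split=> // -[_].
    apply: largeS (lA A i) => w Aw; split=> // -[].
    by rewrite /preimage /= block_index.
  pose C : copies X := Sub C0 C0P.
  have [|D DC DB] := AB C; first by apply/le_copiesP => x [].
  have [f _ fD] := lA D j; have [[w _] _] := Wi j.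
  have [_] : C0 (e j (f w)) by move/le_copiesP: DC; apply; exact: fD.
  apply; split; first by rewrite /preimage /= block_index.
  by move/le_copiesP: DB; apply; exact: fD.
apply/asboolP => C /le_copiesP CA.
(* Each trace of C is large and that of [C \ B] is small, so by indecomposability that of the
   intersection with B is large. *)
have /copiesE DP : forall j, large (e j @^-1` (val C `&` val B)%classic).
  move=> j; have Cj := lA C j.
  have [] := @indecomposable_setU (W j) (e j @^-1` (val C `&` val B)%classic)
    (e j @^-1` (val C `\` val B)%classic) (Wi j) _ => //.
    by apply: largeS Cj => w Cw; case: (pselect (val B (e j w))); [left|right].
  move=> lCB; have /nonembeddingE[] := AB j.
  by apply: largeS lCB => w [Cw Bw]; split=> //; exact: CA.
by exists (Sub (val C `&` val B)%classic DP : copies X); apply/le_copiesP => x [].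
Qed.

End CopiesBlocks.

(** The zero element is the common code of the sets in the ideal, so traces of copies have nonzero
    codes. *)
Lemma presents_eq0 (W : ordinalType) d (B : ctbDistrLatticeType d) (G : set W -> B) :
  (forall S T, (G S <= G T) = `[< nonembedding (S `\` T)%classic >]) ->
  (forall c, exists S, G S = c) -> forall S, (G S != \bot) <-> large S.
Proof.
move=> GE Gs S; rewrite -[large S]notK -nonembeddingE.
split=> [/eqP GS nS|nS]; [apply: GS|apply/eqP => GS; apply: nS].
  have [S0 S0E] := Gs \bot; apply: le_anti; rewrite le0x andbT -S0E GE.
  apply/asboolP; rewrite nonembeddingE => lS; move/nonembeddingE: nS; apply.
  by apply: largeS lS => x [].
have : G S <= G set0 by rewrite GS le0x.
by rewrite GE => /asboolP; rewrite setD0.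
Qed.

(** * The isomorphism for an ordinal in Cantor normal form *)

Theorem theorem3p1 (alpha : ordinalType) (n : nat)
    (gamma : 'I_n.+1 -> ordinalType) (r s : 'I_n.+1 -> nat) (k : nat)
    (alpha_countable : countable [set: alpha])
    (s_pos : forall i, (0 < s i)%N)
    (gammaP : forall i, limit_ordinal (gamma i) \/
                        order_isomorphic (gamma i) (fin_ordinal 1))
    (exponents_increasing : forall i j : 'I_n.+1, (i < j)%N ->
        ordinal_lt (oadd (gamma i) (fin_ordinal (r i)))
                   (oadd (gamma j) (fin_ordinal (r j))))
    (alphaE : order_isomorphic alpha
        (oadd
          (\big[oadd/(fin_ordinal 0 : ordinalType)]_(i < n.+1)
             let j := rev_ord i in
             omul (omega_pow (oadd (gamma j) (fin_ordinal (r j))))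
                  (fin_ordinal (s j)))
          (fin_ordinal k))) :
  order_isomorphic
    (sq (copies alpha))
    (poset_prod (fun i : 'I_n.+1 =>
       poset_pow (nonzero (iter (r i) (@rp set_display) (P_mod_I (gamma i))))
                 (s i))).
Proof.
pose D i := oadd (gamma i) (fin_ordinal (r i)).
pose V i := omul (omega_pow (D i)) (fin_ordinal (s i)).
have [f [fb fm]] := alphaE.
(* The decomposition is built in stages: the summands, then the [s i] copies inside each, then the
   [k] tail points, all pulled back to [alpha]. *)
have [b1 b1V] := blocks_big_oadd (fun i => V (rev_ord i)).
have [b2 b2W] := blocks_comp (K := fun i => 'I_(s i))
  (rank := fun i l => nat_of_ord l)
  (blocks_reindex (@rev_ordK n.+1) b1V) (fun i => blocks_omul (omega_pow (D i)) (s i)).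
have bW := blocks_iso fb fm (blocks_oadd b2W (blocks_fin_ordinal k)).
have revE (i j : 'I_n.+1) : (rev_ord i < rev_ord j)%N = (j < i)%N.
  by rewrite /= !subSS; apply: ltn_sub2lE; rewrite -ltnS.
set prec := (X in blocks X) in bW; set W := (X in blocks _ X) in bW.
have prec_total i j : [\/ prec i j, i = j | prec j i].
  case: i j => [[i l]|l] [[j m]|m]; rewrite /prec /= ?revE.
  - case: (ltngtP i j) => [ij|ji|/val_inj ij].
    + by apply: Or33; left.
    + by apply: Or31; left.
    subst j; case: (ltngtP l m) => [lm|ml|/val_inj->].
    + by apply: Or31; right.
    + by apply: Or33; right.
    + exact: Or32.
  - exact: Or31.
  - exact: Or33.
  - case: (ltngtP l m) => [lm|ml|/val_inj->]; [exact: Or31|exact: Or33|exact: Or32].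
have Wi j : indecomposable (W j).
  by case: j => j; [exact: indecomposable_omega_pow|exact: indecomposable1].
have Wemb i j : prec i j -> exists f : W j -> W i, {homo f : v w / v < w}.
  case: i j => [[i l]|l] [[j m]|m] //=; rewrite /prec /= ?revE.
  (* Along [alpha] the outer index decreases, so a later block has the same or a smaller exponent,
     and an embedding of exponents induces one of powers. *)
  - case=> [ji|[ij _]]; last by subst j; exists id.
    have [h [hm _]] := exponents_increasing _ _ ji.
    by apply: (@omega_pow_homo _ _ h) => x y; rewrite (leW_mono hm).
  - by move=> _; exists (fun=> opow0 _) => v w; rewrite fin_ordinal1_lt.
  - by move=> _; exists id.
pose G i := projT1 (cid2 (presents_iter_rp (gamma i) (r i))).
have [GE Gs] : (forall i S T, (G i S <= G i T) = `[< nonembedding (S `\` T)%classic >])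
    /\ forall i c, exists S, G i S = c.
  by split=> i; rewrite /G; case: cid2.
pose e := block_emb bW.
have F0 (A : copies alpha) i (l : 'I_(s i)) :
    G i (e (inl (Tagged _ l)) @^-1` val A) != \bot.
  apply/(presents_eq0 (GE i) (Gs i)).
  exact: (copiesE bW prec_total Wi Wemb (val A)).1 (valP A) (inl (Tagged _ l)).
pose B i := iter (r i) (@rp set_display) (P_mod_I (gamma i)).
pose Q : porderType _ := poset_prod (fun i => poset_pow (nonzero (B i)) (s i)).
pose F (A : copies alpha) : Q :=
  fun i l => Sub (G i (e (inl (Tagged _ l)) @^-1` val A)) (F0 A i l) : nonzero (B i).
apply: (@sq_isomorphic _ _ _ _ F) => [A A'|c].
  apply/asboolP/idP => [FAA'|/(le_star_copies bW prec_total Wi Wemb) AA' i].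
    apply/(le_star_copies bW prec_total Wi Wemb) => -[[i l]|l].
      have /asboolP/(_ l) := FAA' i.
      by rewrite leEsub /= GE => /asboolP.
    (* A tail block is a single point, which the copy [A'] contains, so the difference has an empty
       trace there. *)
    rewrite nonembeddingE => -[h _ hAA'].
    have [h' _ h'A'] := (copiesE bW prec_total Wi Wemb (val A')).1 (valP A') (inr l).
    have [_ []] := hAA' (ord0 : 'I_1).
    have -> : h (ord0 : 'I_1) = h' (ord0 : 'I_1).
      by rewrite [LHS](ord1 (_ : 'I_1)) [RHS](ord1 (_ : 'I_1)).
    exact: h'A'.
  apply/asboolP => l; rewrite leEsub /= GE; apply/asboolP.
  exact: (AA' (inl (Tagged _ l))).
pose S (u : {i & 'I_(s i)}) := projT1 (cid (Gs (tag u) (val (c (tag u) (tagged u))))).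
have SE u : G (tag u) (S u) = val (c (tag u) (tagged u)) by rewrite /S; case: cid.
(* Tail blocks are taken whole, which makes the glued set large there too. *)
pose S' j : set (W j) := match j with inl u => S u | inr _ => setT end.
have [A0 A0E] := block_glue_set bW S'.
have A0P : `[< is_copy A0 >].
  apply/(copiesE bW prec_total Wi Wemb) => -[u|l]; rewrite A0E /=; last by exists id.
  apply/(presents_eq0 (GE (tag u)) (Gs (tag u))); rewrite SE.
  exact: (valP (c (tag u) (tagged u))).
exists (Sub A0 A0P); apply: functional_extensionality_dep => i.
apply: functional_extensionality_dep => l; apply: val_inj.
by rewrite -(SE (Tagged _ l)) -[S _](A0E (inl (Tagged _ l))).
Qed.
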